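(* Let $(U,\rho)$ be a finite metric space and $T$ a 2-HST of $U$ (as in the context). Let $C_0$ be the set of $k$ initial centers output by the NDP-HST initialization. Then $$\mathrm{cost}^{T}_k(U)\le 10\,\mathrm{OPT}^T_k(U).$$
   Context: $(U,\rho)$ is a finite metric space with $|U|=n$, minimum interpoint distance $1$ and diameter $\Delta$; $L=\log_2\Delta$ is assumed to be an integer. A 2-HST of $U$ is a rooted tree $T$ whose nodes are subsets (clusters) of $U$, obtained by recursive padded decompositions: the root has level $L$; the children of a node at level $i$ are at level $i-1$ and partition its cluster into pieces of diameter at most $\Delta/2^{L-i+1}$; the leaves are in one-to-one correspondence with the points of $U$. $h_v$ denotes the level of node $v$, $T(v)$ the subtree rooted at $v$. The tree metric $\rho^T(x,y)$ is the weighted path distance between the leaves of $x$ and $y$, where an edge joining a node at level $i$ to its child at level $i-1$ has weight $2^{i-1}$. NDP-HST initialization: for every node $v$ let $N_v=|U\cap T(v)|$ and $\mathrm{score}(v)=N_v\cdot 2^{h_v}$. Subtree search: start with $C_1=\emptyset$; while $|C_1|<k$, add to $C_1$ the $k-|C_1|$ highest-score nodes (never re-selecting nodes in $C_1$ or their ancestors), then remove from $C_1$ every node having a descendant in $C_1$; the final $C_1$ consists of $k$ nodes with pairwise disjoint subtrees. Leaf search: for each $v\in C_1$, repeatedly replace $v$ by its child $w$ with largest $N_w$ until a leaf is reached; $C_0$ is the set of the $k$ resulting leaf points. Costs: $\mathrm{cost}^T_k(U)=\sum_{y\in U}\min_{x\in C_0}\rho^T(x,y)$ and $\mathrm{OPT}^T_k(U)=\min_{F\subseteq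 U,|F|=k}\sum_{y\in U}\min_{x\in F}\rho^T(x,y)$. *)

(* Defs.v *)
From HB Require Import structures.
From mathcomp Require Import classical_sets reals exp.
From mathcomp Require Import all_boot all_order all_algebra.
Set Implicit Arguments.
Unset Strict Implicit.
Unset Printing Implicit Defensive.
Import Order.TTheory GRing.Theory Num.Theory.
Local Open Scope ring_scope.

Section FiniteMetric.
Variables (R : realType) (U : finType) (rho : U -> U -> R).

Definition is_metric : Prop :=
  [/\ forall x y, 0 <= rho x y,
      forall x y, rho x y = 0 <-> x = y,
      forall x y, rho x y = rho y x
    & forall x y z, rho x z <= rho x y + rho y z].

Definition min_interpoint_dist_1 : Prop :=
  (forall x y, x != y -> 1 <= rho x y) /\
  (exists x y, x != y /\ rho x y = 1).

Definition diam (A : {set U}) : R :=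
  \big[Num.max/0]_(x in A) \big[Num.max/0]_(y in A) rho x y.

End FiniteMetric.

Definition log2 (R : realType) (x : R) : R := ln x / ln 2.

(* The same subset of U may occur at several levels (a cluster may be its own
   only child), so nodes form an abstract type labelled by clusters.  Levels are
   integers because when Delta = 1 the root already has level 0. *)
Record clusterTree (U : finType) := ClusterTree {
  node : finType;
  root : node;
  child : rel node; (* child v w: w is a child of v *)
  level : node -> int;
  cluster : node -> {set U};
  leaf : U -> node
}.

Section Tree.
Variables (R : realType) (U : finType) (T : clusterTree U).
Implicit Types (u v w : node T) (x y : U) (C S : {set node T}).

Definition children v : {set node T} := [set w | child v w].

Definition is_leaf v : bool := children v == set0.

Definition rooted_tree : Prop :=
  [/\ forall v, connect (@child U T) (root T) v,
      forall v, ~~ child v (root T)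
    & forall u v w, child u w -> child v w -> u = v].

Record is_2HST (rho : U -> U -> R) (L : int) : Prop := Is2HST {
  hst_tree : rooted_tree;
  hst_root_level : level (root T) = L;
  hst_root_cluster : cluster (root T) = [set: U];
  hst_child_level : forall v w, child v w -> level w = level v - 1;
  hst_cluster_inj : forall v, {in children v &, injective (@cluster U T)};
  hst_partition : forall v, ~~ is_leaf v ->
    partition [set cluster w | w in children v] (cluster v);
  hst_diam : forall v w, child v w ->
    diam rho (cluster w) <= diam rho [set: U] / 2 ^ (L - level v + 1);
  hst_leaf_inj : injective (@leaf U T);
  hst_leafP : forall v, is_leaf v <-> exists x, v = leaf T x;
  hst_leaf_cluster : forall x, cluster (leaf T x) = [set x]
}.

Definition adjacent : rel (node T) := [rel u v | child u v || child v u].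

Definition edge_weight u v : R :=
  if child u v then 2 ^ (level u - 1) else 2 ^ (level v - 1).

Fixpoint walk_weight u (p : seq (node T)) : R :=
  if p is v :: p' then edge_weight u v + walk_weight v p' else 0.

(* Shortest-path distance of the weighted tree between two leaves; the infimum is
   attained at the unique simple path. *)
Definition tree_dist x y : R :=
  inf [set d : R | exists p : seq (node T),
    [/\ path adjacent (leaf T x) p, last (leaf T x) p = leaf T y
      & d = walk_weight (leaf T x) p]]%classic.

(* The infima below range over finite sets, hence are minima whenever F is
   nonempty and k <= #|U|. *)
Definition cost (F : {set U}) : R :=
  \sum_(y : U) inf [set d : R | exists2 x, x \in F & d = tree_dist x y]%classic.

Definition OPT (k : nat) : R :=
  inf [set c : R | exists2 F : {set U}, #|F| = k & c = cost F]%classic.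

Definition subtree v : {set node T} := [set w | connect (@child U T) v w].

Definition descendant v w : bool := (w != v) && (w \in subtree v).

Definition npoints v : nat := #|[set x | leaf T x \in subtree v]|.

Definition score v : R := (npoints v)%:R * 2 ^ level v.

Definition eligible C : {set node T} :=
  [set v | (v \notin C) && [forall w in C, ~~ descendant v w]].

Definition highest_score_subset (m : nat) (A S : {set node T}) : Prop :=
  [/\ S \subset A, #|S| = m
    & forall s t, s \in S -> t \in A -> t \notin S -> score t <= score s].

Definition prune C : {set node T} :=
  [set v in C | [forall w in C, ~~ descendant v w]].

(* The states reachable by the while loop; relational because score ties are
   broken arbitrarily. *)
Inductive search_state (k : nat) : {set node T} -> Prop :=
| search_start : search_state k set0
| search_round C S : search_state k C -> (#|C| < k)%N ->
    highest_score_subset (k - #|C|) (eligible C) S ->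
    search_state k (prune (C :|: S)).

Definition subtree_search (k : nat) C1 : Prop :=
  search_state k C1 /\ ~~ (#|C1| < k)%N.

Inductive leaf_search : node T -> U -> Prop :=
| leaf_search_stop x : leaf_search (leaf T x) x
| leaf_search_step v w x : child v w ->
    (forall w', child v w' -> (npoints w' <= npoints w)%N) ->
    leaf_search w x -> leaf_search v x.

Definition NDP_HST (k : nat) (C0 : {set U}) : Prop :=
  exists (C1 : {set node T}) (f : node T -> U),
    [/\ subtree_search k C1, forall v, v \in C1 -> leaf_search v (f v)
      & C0 = [set f v | v in C1]].

End Tree.

(* Main.v *)
(** Let [W F] be the total score of the nodes with no point of [F] below them.
    Exchanging sums, [W F] is the total climb of all points to their lowest
    ancestor containing a center; the descent to a center costs at most twice the
    climb, so [W F <= cost F <= 3 W F].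

    Scores at least halve from parent to child. Hence the ancestors of the nodes
    [C1] of the subtree search are always the nodes of highest score, and the
    scores along a downward path sum to at most twice the first one. Let [F] be a
    set of [k] centers. The score covered by [F] but not by [C0] splits into one
    contribution per [x] in [F], each at most [2 m] with [m] the least score in
    [C1]. In the subtree of each [v] in [C1] that meets [F], one such contribution
    is at most twice the score of a node there covered by [C0] only (where the
    heavy path departs from [F]). The remaining ones are as many as the nodes of
    [C1] missed by [F], each of score at least [m]. So [W C0 <= 2 W F], and
    [cost C0 <= 6 cost F]. *)

Require Import Defs.
From mathcomp Require Import classical_sets reals exp.
From mathcomp Require Import all_boot all_order all_algebra.
From mathcomp Require Import lra.
Set Implicit Arguments.
Unset Strict Implicit.
Unset Printing Implicit Defensive.
Import Order.TTheory GRing.Theory Num.Theory.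
Local Open Scope ring_scope.

(** * Sums over finite types *)

Lemma ler_sum_sub (R : numDomainType) (I : finType) (P Q : pred I) (g : I -> R) :
  (forall i, 0 <= g i) -> (forall i, P i -> Q i) ->
  \sum_(i | P i) g i <= \sum_(i | Q i) g i.
Proof.
move=> g0 PQ; rewrite big_mkcond [leRHS]big_mkcond; apply: ler_sum => i _.
by case: ifP => [/PQ ->|_] //; case: ifP.
Qed.

Lemma sum_uniq_cond (R : nmodType) (I : finType) (s : seq I) (P : pred I)
    (g : I -> R) :
  uniq s -> \sum_(i <- s | P i) g i = \sum_(i | (i \in s) && P i) g i.
Proof. by move=> us; rewrite big_mkcond big_uniq // [RHS]big_mkcondr. Qed.

Section HST.
Variables (R : realType) (U : finType) (rho : U -> U -> R) (L : int).
Variable T : clusterTree U.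
Hypothesis hst : is_2HST T rho L.
Implicit Types (u v w z : node T) (x y : U) (p : seq (node T)).
Implicit Types (C S : {set node T}) (F : {set U}).

Local Notation anc := (connect (@child U T)).
Local Notation pow v := (2 ^ level v : R).
Local Notation score := (score R).

(** * Ancestors, paths and levels *)

Lemma parent_uniq u v w : child u w -> child v w -> u = v.
Proof. by case: (hst_tree hst) => _ _; apply. Qed.

Lemma anc_root v : anc (Defs.root T) v.
Proof. by case: (hst_tree hst). Qed.

Lemma path_level_lt u p z : path (@child U T) u p -> z \in p -> level z < level u.
Proof.
elim: p u => //= w p IH u /andP[uw wp].
have lt : level w < level u by rewrite (hst_child_level hst uw) ltrBlDr ltrDl.
rewrite inE => /orP[/eqP-> //|zp]; exact: lt_trans (IH _ wp zp) lt.
Qed.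

Lemma path_uniq u p : path (@child U T) u p -> uniq (u :: p).
Proof.
elim: p u => //= w p IH u /andP[uw wp].
have /= -> := IH _ wp; rewrite andbT; apply/negP => up.
by have := @path_level_lt u (w :: p) u; rewrite /= uw wp up ltxx => /(_ isT isT).
Qed.

Lemma anc_level_lt v w : anc v w -> v != w -> level w < level v.
Proof.
case/connectP => -[|z p] pp ->; first by rewrite eqxx.
by move=> _; apply: (path_level_lt pp); rewrite /= mem_last.
Qed.

(** Parents are unique, so two downward paths to the same node, read backwards, agree until one of
    them ends. *)
Lemma anc_last u p w :
  path (@child U T) u p -> anc w (last u p) -> w \in u :: p \/ anc w u.
Proof.
elim/last_ind: p => [_ /= ?|p z IH]; first by right.
rewrite rcons_path last_rcons => /andP[up pz] /connectP[q].
case/lastP: q => [|q z']; first by move=> _ ->; left; rewrite inE mem_rcons mem_head orbT.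
rewrite rcons_path last_rcons => /andP[wq qz] zz; rewrite -zz {z' zz} in qz.
have aw : anc w (last u p) by rewrite (parent_uniq pz qz); apply/connectP; exists q.
case: (IH up aw) => [wp|]; [left|by right].
by move: wp; rewrite !inE mem_rcons inE => /orP[->|->]; rewrite ?orbT.
Qed.

Lemma path_anc_last u p v :
  path (@child U T) u p -> v \in u :: p -> anc v (last u p).
Proof.
elim: p u => [|w p IH] u /=; first by rewrite inE => _ /eqP ->.
case/andP=> uw wp; rewrite inE => /orP[/eqP ->|]; last exact: IH.
by apply: connect_trans (connect1 uw) _; apply/connectP; exists p.
Qed.

Lemma anc_total v w z : anc v z -> anc w z -> anc v w || anc w v.
Proof.
move=> vz /connectP[p wp zE]; rewrite zE in vz.
case: (anc_last wp vz) => [vp|->] //.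
by rewrite (path_connect wp vp) orbT.
Qed.

Lemma leaf_nochild x w : ~~ child (leaf T x) w.
Proof.
have : is_leaf (leaf T x) by apply/(hst_leafP hst); exists x.
by move/eqP/setP/(_ w); rewrite !inE => ->.
Qed.

Lemma anc_leaf x v : anc (leaf T x) v -> v = leaf T x.
Proof.
case/connectP => -[|w p] //= /andP[lw _].
by have := leaf_nochild x w; rewrite lw.
Qed.

Lemma ex_leaf v : exists x, anc v (leaf T x).
Proof.
(* A descendant of [v] of minimal level has no child. *)
case: (arg_minP (@level U T) (connect0 _ v : anc v v)) => w vw wmin.
suff /(hst_leafP hst)[x wE] : is_leaf w by exists x; rewrite -wE.
apply/eqP/setP => z; rewrite !inE; apply/negP => wz.
have := wmin z (connect_trans vw (connect1 wz)).
by rewrite (hst_child_level hst wz) leNgt ltrBlDr ltrDl.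
Qed.

(** * Level weights and scores along downward paths *)

Lemma pow_gt0 v : 0 < pow v.
Proof. by rewrite exprz_gt0. Qed.

Lemma pow_child v w : child v w -> pow v = 2 * pow w.
Proof.
move=> vw; rewrite (hst_child_level hst vw) -[X in X * _]expr1z -expfzDr ?pnatr_eq0 //.
by rewrite addrC subrK.
Qed.

Lemma npoints_anc v w : anc v w -> (npoints w <= npoints v)%N.
Proof.
move=> vw; apply/subset_leq_card/subsetP => x; rewrite !inE.
exact: connect_trans.
Qed.

Lemma npoints_gt0 v : (0 < npoints v)%N.
Proof. by have [x vx] := ex_leaf v; apply/card_gt0P; exists x; rewrite !inE. Qed.

Lemma score_gt0 v : 0 < score v.
Proof. by rewrite mulr_gt0 ?pow_gt0 // ltr0n npoints_gt0. Qed.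

Lemma score_ge0 v : 0 <= score v.
Proof. exact/ltW/score_gt0. Qed.

Lemma score_child v w : child v w -> 2 * score w <= score v.
Proof.
move=> vw; rewrite /Defs.score (pow_child vw) mulrCA ler_pM2r ?mulr_gt0 ?pow_gt0 //.
by rewrite ler_nat npoints_anc ?connect1.
Qed.

(** [npoints] may stay constant along an edge; strictness comes from the level. *)
Lemma score_anc v w : anc v w -> v != w -> score w < score v.
Proof.
move=> vw ne; rewrite /Defs.score; apply: (@le_lt_trans _ _ ((npoints v)%:R * pow w)).
  by rewrite ler_pM2r ?pow_gt0 // ler_nat npoints_anc.
rewrite ltr_pM2l ?ltr0n ?npoints_gt0 //.
by rewrite ltr_eXz2l ?ltr1n // anc_level_lt.
Qed.

(** A geometric series of ratio at most 1/2. *)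
Lemma score_path u p :
  path (@child U T) u p -> \sum_(v <- u :: p) score v <= 2 * score u.
Proof.
elim: p u => [|w p IH] u /=.
  by move=> _; rewrite big_seq1; have := score_ge0 u; lra.
case/andP=> uw wp; rewrite big_cons; have := IH _ wp; have := score_child uw; lra.
Qed.

(** * The cost of a set of centers *)

Definition covered F v := [exists x in F, anc v (leaf T x)].

Lemma coveredP F v :
  reflect (exists2 x, x \in F & anc v (leaf T x)) (covered F v).
Proof. exact: exists_inP. Qed.

Lemma covered_anc F v w : anc v w -> covered F w -> covered F v.
Proof.
by move=> vw /coveredP[x xF wx]; apply/coveredP; exists x => //; apply: connect_trans wx.
Qed.

Definition uncovered_score F : R := \sum_(v | ~~ covered F v) score v.

(** [score v] counts [pow v] once per point below [v]. Since [pow v] is the weight of the edge just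
    above [v], for nonempty [F] the inner sum is the climb from [y] to its lowest covered
    ancestor. *)
Lemma uncovered_scoreE F :
  uncovered_score F =
  \sum_y \sum_(v | anc v (leaf T y) && ~~ covered F v) pow v.
Proof.
under [RHS]eq_bigr do rewrite big_mkcondl.
rewrite exchange_big /=; apply: eq_bigr => v _.
rewrite -big_mkcond /= sumr_const /Defs.score mulr_natl; congr (_ *+ _).
by apply: eq_card => x; rewrite !inE.
Qed.

(** * Walks and the tree distance *)

Lemma edge_weight_ge0 u v : 0 <= edge_weight R u v.
Proof. by rewrite /edge_weight; case: ifP => _; rewrite exprz_ge0. Qed.

Lemma walk_weight_ge0 u p : 0 <= walk_weight R u p.
Proof. by elim: p u => //= v p IH u; rewrite addr_ge0 ?edge_weight_ge0. Qed.

Lemma edge_weight_child u v : child u v -> edge_weight R u v = pow v.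
Proof. by move=> uv; rewrite /edge_weight uv (hst_child_level hst uv). Qed.

Lemma edge_weight_sym u v : child u v -> edge_weight R v u = pow v.
Proof.
move=> uv; rewrite /edge_weight ifN; first by rewrite (hst_child_level hst uv).
apply/negP => vu; have := hst_child_level hst vu.
by rewrite (hst_child_level hst uv) -addrA => /eqP; rewrite addrC -subr_eq subrr.
Qed.

Lemma walk_weight_cat u p q :
  walk_weight R u (p ++ q) = walk_weight R u p + walk_weight R (last u p) q.
Proof. by elim: p u => [|v p IH] u /=; rewrite ?add0r // IH addrA. Qed.

Lemma child_walk u p : path (@child U T) u p ->
  path (@adjacent U T) u p /\ walk_weight R u p = \sum_(v <- p) pow v.
Proof.
elim: p u => [|v p IH] u /=; first by rewrite big_nil.
case/andP=> uv /IH[vp ->]; rewrite big_cons edge_weight_child //.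
by split => //; rewrite /adjacent /= uv.
Qed.

(** Each edge of the climb weighs the difference of [pow] at its two ends, so the total
    telescopes. *)
Lemma rev_child_walk u p : path (@child U T) u p ->
  exists q, [/\ path (@adjacent U T) (last u p) q, last (last u p) q = u
    & walk_weight R (last u p) q + pow (last u p) = pow u].
Proof.
elim: p u => [|v p IH] u /=; first by exists [::]; rewrite add0r.
case/andP=> uv /IH[q [qp qv qw]]; exists (q ++ [:: u]).
rewrite cat_path last_cat walk_weight_cat qv /= qp /adjacent /= uv orbT; split=> //.
rewrite edge_weight_sym // (pow_child uv); lra.
Qed.

Lemma tree_dist_le x y p :
  path (@adjacent U T) (leaf T x) p -> last (leaf T x) p = leaf T y ->
  tree_dist R T x y <= walk_weight R (leaf T x) p.
Proof.
move=> px py; apply: ge_inf; last by exists p.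
by exists 0 => _ [q [_ _ ->]]; apply: walk_weight_ge0.
Qed.

(* The right-hand side, seen as a function of the position of [x] in the tree,
   is a potential that varies along each edge by at most the edge weight. *)
Lemma tree_dist_ge x y :
  \sum_(v | anc v (leaf T y) && ~~ anc v (leaf T x)) pow v <= tree_dist R T x y.
Proof.
have pow0 v : 0 <= pow v by rewrite ltW ?pow_gt0.
apply: lb_le_inf.
  have /connectP[p rp pE] := anc_root (leaf T x).
  have /connectP[p' rp' pE'] := anc_root (leaf T y).
  have [q [qp ql _]] := rev_child_walk rp; rewrite -pE in qp ql.
  exists (walk_weight R (leaf T x) (q ++ p')), (q ++ p').
  by rewrite cat_path last_cat ql qp -pE' (child_walk rp').1.
move=> _ [p [px py ->]]; elim: p (leaf T x) px py => [|w p IH] u /= px py.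
  by rewrite big1 // => v; rewrite -py => /andP[->].
case/andP: px => uw wp; apply: le_trans (lerD (lexx _) (IH _ wp py)).
(* Going down, the only new ancestor is [w], and the edge weighs [pow w]; going up, ancestors are
   only lost and the potential cannot drop. *)
have [cuw|ncuw] := boolP (child u w).
  apply: le_trans (_ : \sum_(v | anc v (leaf T y) && ~~ anc v u && (v != w)) pow v
                       + pow w <= _).
    have [Pw|nPw] := boolP (anc w (leaf T y) && ~~ anc w u).
      by rewrite (bigD1 w Pw) addrC.
    rewrite (eq_bigl (fun v => anc v (leaf T y) && ~~ anc v u && (v != w))).
      by rewrite lerDl.
    by move=> v; case: eqP => [->|]; rewrite ?andbT ?andbF // (negPf nPw).
  rewrite addrC edge_weight_child // lerD2l.
  apply: ler_sum_sub => // v /andP[/andP[-> nvu] nvw] /=.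
  apply: contra nvu => vw; have uwp : path (@child U T) u [:: w] by rewrite /= cuw.
  case: (anc_last uwp vw) => [|-> //].
  by rewrite !inE (negPf nvw) orbF => /eqP ->; apply: connect0.
move: uw; rewrite /adjacent /= (negPf ncuw) /= => cwu.
apply: (@le_trans _ _ (\sum_(v | anc v (leaf T y) && ~~ anc v w) pow v)).
  apply: ler_sum_sub => // v /andP[-> nvu] /=.
  by apply: contra nvu => vw; apply: connect_trans vw (connect1 cwu).
by rewrite lerDr edge_weight_ge0.
Qed.

(** * Cost against uncovered score *)

Lemma uncovered_score_le_cost F : F != set0 -> uncovered_score F <= cost R T F.
Proof.
case/set0Pn => x0 x0F; rewrite uncovered_scoreE; apply: ler_sum => y _.
apply: lb_le_inf => [|_ [x xF ->]]; first by exists (tree_dist R T x0 y), x0.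
apply: le_trans (tree_dist_ge x y); apply: ler_sum_sub => [v|v /andP[-> nc]].
  by rewrite ltW ?pow_gt0.
by apply: contra nc => vx; apply/coveredP; exists x.
Qed.

(** At the first uncovered node [w] of the path, its parent has a center [x] below it. The walk from
    [x] up to that parent weighs less than [2 * pow w], and the descent to [y] uses only uncovered
    nodes: hence the factor 3. *)
Lemma near_center F y u p :
  path (@child U T) u p -> last u p = leaf T y -> covered F u ->
  exists2 x, x \in F &
    tree_dist R T x y <= 3 * \sum_(v <- p | ~~ covered F v) pow v.
Proof.
elim: p u => [|w p IH] u /=.
  move=> _ -> /coveredP[x xF /anc_leaf/(hst_leaf_inj hst) xy].
  exists x; rewrite // big_nil mulr0 xy.
  exact: (@tree_dist_le y y [::]).
case/andP=> uw wp py cu; rewrite big_cons; have [cw|ncw] := boolP (covered F w) => /=.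
  exact: IH wp py cw.
have /coveredP[x xF /connectP[q uq qx]] := cu; exists x => //.
have [q' [pq lq wq]] := rev_child_walk uq; rewrite -qx in pq lq wq.
have uwp : path (@child U T) u (w :: p) by rewrite /= uw.
have [ap aw] := child_walk uwp.
apply: le_trans (@tree_dist_le x y (q' ++ w :: p) _ _) _.
- by rewrite cat_path pq lq.
- by rewrite last_cat lq.
rewrite walk_weight_cat lq aw big_cons.
have -> : \sum_(v <- p | ~~ covered F v) pow v = \sum_(v <- p) pow v.
  rewrite big_seq_cond [RHS]big_seq; apply: eq_bigl => v.
  have [vp /=|//] := boolP (v \in p).
  by apply: contra ncw; apply: covered_anc; apply: (path_connect wp); rewrite inE vp orbT.
have : 0 <= \sum_(v <- p) pow v by apply: sumr_ge0 => v _; rewrite ltW ?pow_gt0.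
have := pow_gt0 (leaf T x); have := pow_child uw; lra.
Qed.

Lemma cost_le_uncovered_score F : F != set0 -> cost R T F <= 3 * uncovered_score F.
Proof.
case/set0Pn => x0 x0F; rewrite uncovered_scoreE mulr_sumr; apply: ler_sum => y _.
have /connectP[p rp py] := anc_root (leaf T y).
have [|x xF dxy] := near_center (F := F) rp (esym py).
  by apply/coveredP; exists x0; rewrite ?anc_root.
apply: (@le_trans _ _ (tree_dist R T x y)).
  apply: ge_inf; last by exists x.
  exists 0 => _ [z _ ->]; apply: le_trans (tree_dist_ge z y).
  by apply: sumr_ge0 => v _; rewrite ltW ?pow_gt0.
apply: le_trans dxy _; rewrite ler_pM2l // sum_uniq_cond; last first.
  by have := path_uniq rp => /= /andP[].
apply: ler_sum_sub => [v|v /andP[vp ->]]; first by rewrite ltW ?pow_gt0.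
by rewrite andbT py; apply: (path_anc_last rp); rewrite inE vp orbT.
Qed.

(** * The subtree search *)

(** The upward closure of [C]: unlike [C] it is unchanged by pruning, and its complement is
    [eligible C], so the loop invariant is stated with it. *)
Definition visited C := [set v | [exists w in C, anc v w]].

Lemma visitedP C v : reflect (exists2 w, w \in C & anc v w) (v \in visited C).
Proof. by rewrite inE; apply: exists_inP. Qed.

Lemma eligibleE C : eligible C = ~: visited C.
Proof.
apply/setP => v; rewrite !inE negb_exists_in.
apply/andP/forall_inP => [[vC /forall_inP nd] w wC|na]; last first.
  split; last by apply/forall_inP => w wC; rewrite negb_and inE na ?orbT.
  by apply/negP => /na; rewrite connect0.
have := nd w wC; rewrite negb_and inE negbK => /orP[/eqP wv|//].
by rewrite -wv wC in vC.
Qed.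

Lemma descendantE v w : descendant v w = (v != w) && anc v w.
Proof. by rewrite /descendant inE eq_sym. Qed.

Lemma subset_visited C : C \subset visited C.
Proof. by apply/subsetP => v vC; apply/visitedP; exists v. Qed.

Lemma visited_prune C : visited (prune C) = visited C.
Proof.
apply/setP => v; apply/visitedP/visitedP => -[w wC vw].
  by exists w => //; move: wC; rewrite inE => /andP[].
have Pw : (w \in C) && anc v w by rewrite wC.
(* Scores strictly decrease downwards, so a node of least score among those of [C] below [v]
   survives pruning. *)
case: (arg_minP (P := fun z => (z \in C) && anc v z) (fun z => score z) Pw) => z /andP[zC vz] zmin.
exists z => //; rewrite inE zC /=; apply/forall_inP => t tC; apply/negP.
rewrite descendantE => /andP[ne zt].
have := zmin t; rewrite tC (connect_trans vz zt) => /(_ isT).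
by rewrite leNgt score_anc.
Qed.

Lemma prune_antichain C : {in prune C &, forall v w, anc v w -> v = w}.
Proof.
move=> v w; rewrite !inE => /andP[_ /forall_inP nd] /andP[wC _] vw.
by have := nd w wC; rewrite descendantE vw andbT negbK => /eqP.
Qed.

Lemma search_state_spec k C : search_state R k C ->
  [/\ (#|C| <= k)%N, {in C &, forall v w, anc v w -> v = w}
    & forall v t, v \in visited C -> t \notin visited C -> score t <= score v].
Proof.
elim=> [|{}C S _ [Ck _ IH] Clt [Sel Scard Smax]].
  by split=> [|v w|v t /visitedP[w]]; rewrite ?cards0 ?inE.
split; [| exact: prune_antichain |].
  apply: leq_trans (_ : #|C :|: S| <= _)%N.
    by apply/subset_leq_card/subsetP => v; rewrite inE => /andP[].
  apply: leq_trans (leq_card_setU _ _) _.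
  by rewrite Scard subnKC.
rewrite eligibleE in Sel Smax.
(* An unvisited proper ancestor of a selected node has a larger score, so it was selected too: [S]
   adds no further ancestors. *)
have visU : visited (C :|: S) = visited C :|: S.
  apply/setP => v; apply/idP/idP => [/visitedP[w]|].
    rewrite !in_setU => wCS vw; have [//|nvC /=] := boolP (v \in visited C).
    case/orP: wCS => [wC|wS]; first by case/visitedP: nvC; exists w.
    apply/negPn/negP => nvS; have := Smax w v wS; rewrite in_setC nvC nvS => /(_ isT isT).
    by rewrite leNgt score_anc //; apply: contraNneq nvS => ->.
  rewrite in_setU => /orP[/visitedP[w wC vw]|vS]; apply/visitedP.
    by exists w; rewrite // inE wC.
  by exists v; rewrite // inE vS orbT.
move=> v t; rewrite visited_prune visU !in_setU negb_or => vV /andP[tC tS].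
case/orP: vV => [vC|vS]; first exact: IH.
by apply: Smax; rewrite ?in_setC.
Qed.

Lemma leaf_search_anc v x : leaf_search v x -> anc v (leaf T x).
Proof.
by elim=> [x'|{}v w {}x vw _ _ wx] //; apply: connect_trans (connect1 vw) wx.
Qed.

(** * Comparison with an arbitrary set of centers *)

Section Compare.
Variables F0 F : {set U}.

(** The contribution of a center [x] of [F] to the score that [F0] misses; a node above several
    centers is counted for each of them. *)
Definition residual x : R :=
  \sum_(v | anc v (leaf T x) && ~~ covered F0 v) score v.

Definition gain v : R :=
  \sum_(w | anc v w && (covered F0 w && ~~ covered F w)) score w.

Lemma gain_ge0 v : 0 <= gain v.
Proof. by apply: sumr_ge0 => w _; apply: score_ge0. Qed.

Lemma gain_anc v w : anc v w -> gain w <= gain v.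
Proof.
move=> vw; apply: ler_sum_sub => [u|u /andP[wu ->]]; first exact: score_ge0.
by rewrite (connect_trans vw wu).
Qed.

Lemma score_le_gain v w :
  anc v w -> covered F0 w -> ~~ covered F w -> score w <= gain v.
Proof.
move=> vw c0 nc; rewrite /gain (bigD1 w) /=; last by rewrite vw c0 nc.
by rewrite lerDl; apply: sumr_ge0 => u _; apply: score_ge0.
Qed.

(** The nodes that count lie on the path from [w] to [x], since everything from [v] upwards is
    covered. *)
Lemma residual_below v w x :
  covered F0 v -> child v w -> anc w (leaf T x) -> residual x <= 2 * score w.
Proof.
move=> cv vw /connectP[p wp px]; apply: le_trans (score_path wp).
rewrite sum_uniq_cond ?path_uniq //; apply: ler_sum_sub => [u|u /andP[ux nu]].
  exact: score_ge0.
have vwp : path (@child U T) v (w :: p) by rewrite /= vw.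
rewrite px in ux; rewrite andbT; case: (anc_last (w := u) vwp ux) => [|uv].
  by rewrite inE => /orP[/eqP uv|//]; rewrite uv cv in nu.
by rewrite (covered_anc uv cv) in nu.
Qed.

Lemma residual_covered x : x \in F0 -> residual x = 0.
Proof.
move=> xF; rewrite /residual big1 // => v /andP[vx] /negP[].
by apply/coveredP; exists x.
Qed.

(** The root is covered; on the way down to [x], [residual_below] applies at the first uncovered
    node, if there is one. *)
Lemma residual_le (tau : R) x : F0 != set0 -> 0 <= tau ->
  (forall v, ~~ covered F0 v -> score v <= tau) -> residual x <= 2 * tau.
Proof.
case/set0Pn=> x0 x0F tau0 Htau.
have cr : covered F0 (Defs.root T) by apply/coveredP; exists x0; rewrite ?anc_root.
have /connectP[p] := anc_root (leaf T x).
elim: p (Defs.root T) cr => [|w p IH] u cu /=.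
  move=> _ xu; rewrite /residual big1 ?mulr_ge0 // => v /andP[vx] /negP[].
  by rewrite xu in vx; apply: covered_anc vx cu.
case/andP=> uw wp px; have [cw|ncw] := boolP (covered F0 w); first exact: IH cw wp px.
apply: le_trans (residual_below cu uw _) _; first by apply/connectP; exists p.
by rewrite ler_pM2l // Htau.
Qed.

(* Where the heavy path of the leaf search leaves [F], the child it takes has at
   least the score of any sibling containing a center of [F]. *)
Lemma leaf_search_residual v g : leaf_search v g -> g \in F0 -> covered F v ->
  exists x, [/\ x \in F, anc v (leaf T x) & residual x <= 2 * gain v].
Proof.
elim=> [g'|{}v w {}g vw wmax wg IH] gF0 /coveredP[x xF vx].
  have /(hst_leaf_inj hst) xg := anc_leaf vx; rewrite xg in xF.
  by exists g'; rewrite residual_covered // mulr_ge0 ?gain_ge0.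
have vaw : anc v w := connect1 vw.
have [cw|ncw] := boolP (covered F w).
  have [z [zF wz rz]] := IH gF0 cw; exists z; split=> //.
    exact: connect_trans vaw wz.
  by apply: le_trans rz _; rewrite ler_pM2l // gain_anc.
exists x; split=> //.
have c0w : covered F0 w by apply/coveredP; exists g => //; apply: leaf_search_anc.
have c0v := covered_anc vaw c0w.
have sw := score_le_gain vaw c0w ncw.
case/connectP: vx => -[|w' p] /= pp lE.
  by have := leaf_nochild x w; rewrite lE vw.
case/andP: pp => vw' wp.
apply: le_trans (residual_below c0v vw' _) _; first by apply/connectP; exists p.
rewrite ler_pM2l //; apply: le_trans sw.
rewrite /Defs.score (hst_child_level hst vw) (hst_child_level hst vw').
by rewrite ler_pM2r ?exprz_gt0 // ler_nat wmax.
Qed.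

End Compare.

Lemma anc_antichain_disjoint C v w z :
  {in C &, forall v w, anc v w -> v = w} -> v \in C -> w \in C ->
  anc v z -> anc w z -> v = w.
Proof.
move=> anti vC wC vz wz; case/orP: (anc_total vz wz) => a; first exact: anti.
by apply/esym/anti.
Qed.

Lemma uncovered_score_NDP k (C0 F : {set U}) : (0 < k)%N -> NDP_HST R T k C0 -> #|F| = k ->
  uncovered_score C0 <= 2 * uncovered_score F.
Proof.
move=> k0 [C1 [f [[st kC] lf C0E]]] Fk.
have [Ck anti vis] := search_state_spec st.
have {kC Ck} C1k : #|C1| = k by apply/eqP; rewrite eqn_leq Ck leqNgt.
have fC0 v : v \in C1 -> f v \in C0 by move=> vC; rewrite C0E imset_f.
have cC1 v : v \in C1 -> covered C0 v.
  by move=> vC; apply/coveredP; exists (f v); [apply: fC0|apply/leaf_search_anc/lf].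
have [v0 v0C] : exists v, v \in C1 by apply/card_gt0P; rewrite C1k.
case: (arg_minP (P := [in C1]) (fun v => score v) v0C) => m mC mmin.
have C0n0 : C0 != set0 by apply/set0Pn; exists (f m); apply: fC0.
(* A node not covered by [C0] is not visited, so it scores at most as much as [m]. *)
have resid x : residual C0 x <= 2 * score m.
  apply: residual_le => // [|v ncv]; first exact: score_ge0.
  apply: vis; first exact: (subsetP (subset_visited _)).
  by apply: contra ncv => /visitedP[w wC vw]; apply: covered_anc vw (cC1 _ wC).
pose B := [set v in C1 | covered F v].
have exB v : exists x, v \in B ->
    [/\ x \in F, anc v (leaf T x) & residual C0 x <= 2 * gain C0 F v].
  (* Outside [B], [f v] is a default value that makes the choice function total. *)
  have [|nvB] := boolP (v \in B); last by exists (f v).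
  rewrite inE => /andP[vC cv].
  by have [x Hx] := leaf_search_residual (lf v vC) (fC0 v vC) cv; exists x.
have [xi xiP] := fin_all_exists exB.
have BC v : v \in B -> v \in C1 by rewrite inE => /andP[].
have xi_inj : {in B &, injective xi}.
  move=> v w vB wB E; have [_ vx _] := xiP v vB; have [_ wx _] := xiP w wB.
  by rewrite -E in wx; apply: (anc_antichain_disjoint anti (BC _ vB) (BC _ wB) vx wx).
have xiF : xi @: B \subset F.
  by apply/subsetP => _ /imsetP[v vB ->]; case: (xiP v vB).
have sumF : \sum_(x in F) residual C0 x <= 2 * \sum_(v in C1) gain C0 F v.
  rewrite (big_setID (xi @: B)) /= (setIidPr xiF) big_imset //=.
  rewrite [in leRHS](big_setID B) /= mulrDr; apply: lerD.
    rewrite (setIidPr _); last by apply/subsetP.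
    by rewrite mulr_sumr; apply: ler_sum => v vB; case: (xiP v vB).
  apply: (@le_trans _ _ (\sum_(x in F :\: xi @: B) 2 * score m)).
    by apply: ler_sum => x _; apply: resid.
  have -> : \sum_(x in F :\: xi @: B) 2 * score m =
            \sum_(v in C1 :\: B) 2 * score m.
    (* Both index sets have [k - #|B|] elements, as [xi] is injective on [B]. *)
    rewrite !sumr_const; congr (_ *+ _).
    rewrite !cardsD (setIidPr xiF) (setIidPr _); last by apply/subsetP.
    by rewrite card_in_imset // Fk C1k.
  rewrite mulr_sumr; apply: ler_sum => v; rewrite !inE => /andP[nB vC].
  rewrite ler_pM2l //; apply: le_trans (mmin v vC) _.
  apply: score_le_gain => //; first exact: cC1.
  by move: nB; rewrite vC.
(* Each node on the left has a point of [F] below it, so it is counted at least once on the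
   right. *)
have lhs : \sum_(v | covered F v && ~~ covered C0 v) score v
           <= \sum_(x in F) residual C0 x.
  rewrite /residual (exchange_big_dep (fun v => ~~ covered C0 v)) /=; last first.
    by move=> x v _ /andP[].
  rewrite big_mkcondl; apply: ler_sum => v nv; case: ifP => cv; last first.
    by apply: sumr_ge0 => x _; apply: score_ge0.
  have /coveredP[x xF vx] := cv.
  rewrite (bigD1 x) /=; last by rewrite xF vx nv.
  by rewrite lerDl; apply: sumr_ge0 => y _; apply: score_ge0.
(* The subtrees of [C1] are disjoint, so no node is counted twice. *)
have rhs : \sum_(v in C1) gain C0 F v
           <= \sum_(v | covered C0 v && ~~ covered F v) score v.
  rewrite /gain (exchange_big_dep (fun w => covered C0 w && ~~ covered F w)) /=; last first.
    by move=> v w _ /andP[].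
  apply: ler_sum => w cw.
  have [v /andP[vC vw]|none] := pickP (fun v => (v \in C1) && anc v w).
    rewrite (bigD1 v) /=; last by rewrite vC vw cw.
    rewrite big1 ?addr0 // => u /andP[/andP[uC /andP[uw _]]] /eqP[].
    exact: (anc_antichain_disjoint anti uC vC uw vw).
  rewrite big1 ?score_ge0 // => v /and3P[vC vw _].
  by have := none v; rewrite vC vw.
(* Nodes missed by both sets contribute the same amount to both uncovered scores. *)
have rest0 : 0 <= \sum_(v | ~~ covered C0 v && ~~ covered F v) score v.
  by apply: sumr_ge0 => v _; apply: score_ge0.
have E0 : uncovered_score C0 = \sum_(v | covered F v && ~~ covered C0 v) score v
    + \sum_(v | ~~ covered C0 v && ~~ covered F v) score v.
  rewrite /uncovered_score (bigID (covered F)) /=; congr (_ + _).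
  by apply: eq_bigl => v; rewrite andbC.
have EF : uncovered_score F = \sum_(v | covered C0 v && ~~ covered F v) score v
    + \sum_(v | ~~ covered C0 v && ~~ covered F v) score v.
  rewrite /uncovered_score (bigID (covered C0)) /=.
  by congr (_ + _); apply: eq_bigl => v; rewrite andbC.
rewrite E0 EF; lra.
Qed.

End HST.

(** * The approximation bound *)

Theorem mainTheorem3 (R : realType) (U : finType) (rho : U -> U -> R) (L : int)
    (T : clusterTree U) (k : nat) (C0 : {set U}) :
  is_metric rho ->
  min_interpoint_dist_1 rho ->
  log2 (diam rho [set: U]) = L%:~R ->
  is_2HST T rho L ->
  (0 < k <= #|U|)%N ->
  NDP_HST R T k C0 ->
  cost R T C0 <= 10 * OPT R T k.
Proof.
move=> _ _ _ hst /andP[k0 kU] ndp.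
have C0n0 : C0 != set0.
  case: (ndp) => C1 [f [[st kC] _ ->]].
  apply/set0Pn.
  have /card_gt0P[v vC] : (0 < #|C1|)%N by apply: leq_trans k0 _; rewrite leqNgt.
  by exists (f v); rewrite imset_f.
rewrite -ler_pdivrMl //; apply: lb_le_inf.
  (* As [k <= #|U|], the infimum defining [OPT] ranges over a nonempty set. *)
  have [s us sk] : exists2 s : seq U, uniq s & size s = k.
    exists (take k (enum U)); first by rewrite take_uniq ?enum_uniq.
    by rewrite size_takel // -cardE.
  by exists (cost R T [set x in s]), [set x in s] => //; rewrite cardsE (card_uniqP us).
move=> _ [F Fk ->].
have Fn0 : F != set0 by rewrite -card_gt0 Fk.
(* The chain of bounds gives the factor 6; nonnegativity lets it be weakened to 10. *)
have W0 : 0 <= uncovered_score R T F.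
  by apply: sumr_ge0 => v _; apply: (score_ge0 hst).
have := cost_le_uncovered_score hst C0n0.
have := uncovered_score_NDP hst k0 ndp Fk.
have := uncovered_score_le_cost hst Fn0.
rewrite ler_pdivrMl //; lra.
Qed.
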